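(* A non-Abelian three-dimensional real Lie algebra admits a Nijenhuis eigenbasis if and only if it is isomorphic to one of $\mathfrak a_{3,4}$, $\mathfrak a_{3,5}$, or $\mathfrak a_{3,8}$ (the latter for some value of its parameter $b\in\mathbb R$), where these are the real Lie algebras with basis $\eta_1,\eta_2,\eta_3$ and the following non-zero brackets: - $\mathfrak a_{3,4}$: $[\eta_1,\eta_2]=-\eta_3$, $[\eta_2,\eta_3]=\eta_1$, $[\eta_3,\eta_1]=\eta_2$; - $\mathfrak a_{3,5}$: $[\eta_1,\eta_2]=\eta_2$, $[\eta_3,\eta_1]=-\eta_3$; - $\mathfrak a_{3,8}$ (with arbitrary $b\in\mathbb R$): $[\eta_1,\eta_2]=b\eta_2-\eta_3$, $[\eta_3,\eta_1]=\eta_2-b\eta_3$. Moreover: - In $\mathfrak a_{3,4}$ the vectors $\zeta_1=-\eta_1+\eta_2+\eta_3$, $\zeta_2=\eta_1+\eta_2-\eta_3$, $\zeta_3=2\eta_1$ form a Nijenhuis eigenbasis. - In $\mathfrak a_{3,5}$ any basis is a Nijenhuis eigenbasis. - In $\mathfrak a_{3,8}$, for every $b\in\mathbb R$, the vectors $\zeta_1=\eta_1+\eta_3$, $\zeta_2=\eta_1+\eta_2$, $\zeta_3=\eta_2+\eta_3$ form a Nijenhuis eigenbasis.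
   Context: A Nijenhuis eigenbasis of a finite-dimensional Lie algebra $\mathfrak g$ is a basis $\zeta_1,\dots,\zeta_n$ of $\mathfrak g$ such that $[\zeta_i,\zeta_j]$ lies in the linear span of $\zeta_i$ and $\zeta_j$ for all $i,j$. The well-known (Bianchi) classification says that every three-dimensional real Lie algebra is isomorphic to one of the following, given by a basis $\eta_1,\eta_2,\eta_3$ and the non-zero brackets: $\mathfrak a_{3,1}$: Abelian; $\mathfrak a_{3,2}$: $[\eta_2,\eta_3]=\eta_1$; $\mathfrak a_{3,3}$: $[\eta_1,\eta_2]=\eta_3$, $[\eta_2,\eta_3]=\eta_1$, $[\eta_3,\eta_1]=\eta_2$; $\mathfrak a_{3,4}$: $[\eta_1,\eta_2]=-\eta_3$, $[\eta_2,\eta_3]=\eta_1$, $[\eta_3,\eta_1]=\eta_2$; $\mathfrak a_{3,5}$: $[\eta_1,\eta_2]=\eta_2$, $[\eta_3,\eta_1]=-\eta_3$; $\mathfrak a_{3,6}$: $[\eta_1,\eta_2]=\eta_2+\eta_3$, $[\eta_3,\eta_1]=-\eta_3$; $\mathfrak a_{3,7}$: $[\eta_1,\eta_2]=a\eta_2+\eta_3$, $[\eta_3,\eta_1]=\eta_2-a\eta_3$, $a\in\mathbb R$; $\mathfrak a_{3,8}$: $[\eta_1,\eta_2]=b\eta_2-\eta_3$, $[\eta_3,\eta_1]=\eta_2-b\eta_3$, $b\in\mathbb R$. *)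

(* Defs.v *)
From HB Require Import structures.
From mathcomp Require Import all_boot all_order all_algebra.
From mathcomp Require Import ring.

Set Implicit Arguments.
Unset Strict Implicit.
Unset Printing Implicit Defensive.

Import GRing.Theory.
Local Open Scope ring_scope.

(** Finite-dimensional Lie algebras over a field *)

HB.mixin Record Vector_isLieAlgebra (K : fieldType) V of Vector K V := {
  lie : V -> V -> V;
  lie_bilinear : bilinear_for *:%R *:%R lie;
  liexx : forall x, lie x x = 0;
  lie_jacobi : forall x y z,
    lie x (lie y z) + lie y (lie z x) + lie z (lie x y) = 0
}.

#[short(type="lieAlgType")]
HB.structure Definition LieAlgebra (K : fieldType) :=
  { V of Vector_isLieAlgebra K V & Vector K V }.

Definition lie_abelian (K : fieldType) (g : lieAlgType K) : Prop :=
  forall x y : g, lie x y = 0.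

Definition lie_isomorphic (K : fieldType) (g h : lieAlgType K) : Prop :=
  exists f : {linear g -> h}, bijective f /\ {morph f : x y / lie x y}.

Definition nijenhuis_eigenbasis (K : fieldType) (g : lieAlgType K) (n : nat)
    (zeta : n.-tuple g) : Prop :=
  basis_of {:g} zeta /\
  forall i j : 'I_n,
    lie (tnth zeta i) (tnth zeta j) \in <<[:: tnth zeta i; tnth zeta j]>>%VS.

(** Three-dimensional models on ['rV_3] *)

Section Bracket3.
Variable K : fieldType.
Implicit Types c x y : 'rV[K]_3.

Definition eta1 : 'rV[K]_3 := delta_mx 0 0.
Definition eta2 : 'rV[K]_3 := delta_mx 0 1.
Definition eta3 : 'rV[K]_3 := delta_mx 0 2%:R.

(* The alternating bilinear map with [eta1,eta2] = c12, [eta2,eta3] = c23 and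
   [eta3,eta1] = c31. *)
Definition bracket3 c12 c23 c31 x y : 'rV[K]_3 :=
  (x 0 0 * y 0 1 - x 0 1 * y 0 0) *: c12 +
  (x 0 1 * y 0 2%:R - x 0 2%:R * y 0 1) *: c23 +
  (x 0 2%:R * y 0 0 - x 0 0 * y 0 2%:R) *: c31.

Lemma bracket3_bilinear c12 c23 c31 :
  bilinear_for *:%R *:%R (bracket3 c12 c23 c31).
Proof.
by split=> u a x y; apply/rowP=> i; rewrite !mxE; ring.
Qed.

Lemma bracket3xx c12 c23 c31 x : bracket3 c12 c23 c31 x x = 0.
Proof. by apply/rowP=> i; rewrite !mxE; ring. Qed.

Lemma bracket3_eta c12 c23 c31 :
  [/\ bracket3 c12 c23 c31 eta1 eta2 = c12,
      bracket3 c12 c23 c31 eta2 eta3 = c23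
    & bracket3 c12 c23 c31 eta3 eta1 = c31].
Proof. by split; apply/rowP=> i; rewrite !mxE /=; ring. Qed.

End Bracket3.

Arguments eta1 {K}.
Arguments eta2 {K}.
Arguments eta3 {K}.

Definition a34 (K : fieldType) : Type := 'rV[K]_3.
HB.instance Definition _ (K : fieldType) := Vector.on (a34 K).

Definition a34_lie (K : fieldType) : a34 K -> a34 K -> a34 K :=
  bracket3 (- eta3) eta1 eta2.

Lemma a34_bilinear (K : fieldType) :
  bilinear_for *:%R *:%R (@a34_lie K).
Proof. exact: bracket3_bilinear. Qed.

Lemma a34xx (K : fieldType) (x : a34 K) : a34_lie x x = 0.
Proof. exact: bracket3xx. Qed.

Lemma a34_jacobi (K : fieldType) (x y z : a34 K) :
  a34_lie x (a34_lie y z) + a34_lie y (a34_lie z x) +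
  a34_lie z (a34_lie x y) = 0.
Proof. by apply/rowP=> i; rewrite !mxE /=; ring. Qed.

HB.instance Definition _ (K : fieldType) :=
  Vector_isLieAlgebra.Build K (a34 K)
    (@a34_bilinear K) (@a34xx K) (@a34_jacobi K).

Lemma a34_eta (K : fieldType) :
  [/\ lie (eta1 : a34 K) eta2 = - eta3,
      lie (eta2 : a34 K) eta3 = eta1
    & lie (eta3 : a34 K) eta1 = eta2].
Proof. exact: bracket3_eta. Qed.

Definition a35 (K : fieldType) : Type := 'rV[K]_3.
HB.instance Definition _ (K : fieldType) := Vector.on (a35 K).

Definition a35_lie (K : fieldType) : a35 K -> a35 K -> a35 K :=
  bracket3 eta2 0 (- eta3).

Lemma a35_bilinear (K : fieldType) :
  bilinear_for *:%R *:%R (@a35_lie K).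
Proof. exact: bracket3_bilinear. Qed.

Lemma a35xx (K : fieldType) (x : a35 K) : a35_lie x x = 0.
Proof. exact: bracket3xx. Qed.

Lemma a35_jacobi (K : fieldType) (x y z : a35 K) :
  a35_lie x (a35_lie y z) + a35_lie y (a35_lie z x) +
  a35_lie z (a35_lie x y) = 0.
Proof. by apply/rowP=> i; rewrite !mxE /=; ring. Qed.

HB.instance Definition _ (K : fieldType) :=
  Vector_isLieAlgebra.Build K (a35 K)
    (@a35_bilinear K) (@a35xx K) (@a35_jacobi K).

Lemma a35_eta (K : fieldType) :
  [/\ lie (eta1 : a35 K) eta2 = eta2,
      lie (eta2 : a35 K) eta3 = 0
    & lie (eta3 : a35 K) eta1 = - eta3].
Proof. exact: bracket3_eta. Qed.

Definition a38 (K : fieldType) (b : K) : Type := 'rV[K]_3.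
HB.instance Definition _ (K : fieldType) (b : K) := Vector.on (a38 b).

Definition a38_lie (K : fieldType) (b : K) : a38 b -> a38 b -> a38 b :=
  bracket3 (b *: eta2 - eta3) 0 (eta2 - b *: eta3).

Lemma a38_bilinear (K : fieldType) (b : K) :
  bilinear_for *:%R *:%R (@a38_lie K b).
Proof. exact: bracket3_bilinear. Qed.

Lemma a38xx (K : fieldType) (b : K) (x : a38 b) : a38_lie x x = 0.
Proof. exact: bracket3xx. Qed.

Lemma a38_jacobi (K : fieldType) (b : K) (x y z : a38 b) :
  a38_lie x (a38_lie y z) + a38_lie y (a38_lie z x) +
  a38_lie z (a38_lie x y) = 0.
Proof. by apply/rowP=> i; rewrite !mxE /=; ring. Qed.

HB.instance Definition _ (K : fieldType) (b : K) :=
  Vector_isLieAlgebra.Build K (a38 b)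
    (@a38_bilinear K b) (@a38xx K b) (@a38_jacobi K b).

Lemma a38_eta (K : fieldType) (b : K) :
  [/\ lie (eta1 : a38 b) eta2 = b *: eta2 - eta3,
      lie (eta2 : a38 b) eta3 = 0
    & lie (eta3 : a38 b) eta1 = eta2 - b *: eta3].
Proof. exact: bracket3_eta. Qed.

(* Main.v *)
(** In a Nijenhuis eigenbasis the brackets read
      [z1,z2] = p z1 + q z2,  [z2,z3] = r z2 + s z3,  [z3,z1] = t z3 + u z1,
    and the Jacobi identity amounts to r p = s u, t r = u q, p t = q s.  Hence
    either one of the pairs (p,s), (r,u), (t,q) vanishes, or they are all of the
    form (c,-c), or they are all of the form (c,c) with c <> 0.
    If all pairs are (c,-c), then [x,y] = alpha(x) y - alpha(y) x for a linear
    form alpha, which is a35.  If all are (c,c) with c <> 0, rescaling the basis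
    gives the eigenbasis of a34.  If, say, p = s = 0, then z2 spans with a vector
    of <z1,z3> an abelian ideal on which a complementary basis vector acts
    diagonally; this is a35 when the two eigenvalues l, m coincide, and a38 with
    b = (l + m) / (l - m) otherwise. *)

Require Import Defs.
From HB Require Import structures.
From mathcomp Require Import all_boot all_order all_algebra.
From mathcomp Require Import reals ring.

Set Implicit Arguments.
Unset Strict Implicit.
Unset Printing Implicit Defensive.

Import GRing.Theory.
Local Open Scope ring_scope.

(** * Skew symmetry, isomorphisms and spans of two vectors *)

Section LieAlgebras.
Variable K : fieldType.
Implicit Types g h : lieAlgType K.

(** Polarisation: expand [B (x + y) (x + y) = 0]. Bare maps are used because this serves both [lie]
    and a bracket transported to the row space. *)
Lemma alternating_skew (V W : lmodType K) (B : V -> V -> W) :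
  (forall y, linear (B^~ y)) -> (forall x, linear (B x)) ->
  (forall x, B x x = 0) -> forall x y, B y x = - B x y.
Proof.
move=> Bl Br Bxx x y; apply/eqP; rewrite -addr_eq0; apply/eqP.
have := Bxx (1 *: x + y).
by rewrite (Bl _ 1 x y) !(Br _ 1 x y) !Bxx !scale1r add0r addr0 addrC.
Qed.

Lemma lie_linearl g (y : g) : linear (lie^~ y).
Proof. by move=> a x z; exact: (lie_bilinear.1 y a x z). Qed.

Lemma lie_linearr g (x : g) : linear (lie x).
Proof. by move=> a y z; exact: (lie_bilinear.2 x a y z). Qed.

Lemma lieC g (x y : g) : lie y x = - lie x y.
Proof.
exact: (alternating_skew (@lie_linearl g) (@lie_linearr g) (@liexx K g)).
Qed.

(** Coordinate maps run from the row space into [g], opposite to the direction in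
    [lie_isomorphic]. *)
Lemma lie_isomorphic_inv g h (f : {linear h -> g}) :
  bijective f -> {morph f : x y / lie x y} -> lie_isomorphic g h.
Proof.
case=> f' fK f'K fM.
have f'L : linear f' by apply: (can2_linear fK f'K).
pose F : {linear g -> h} := HB.pack f' (GRing.isLinear.Build _ _ _ _ f' f'L).
exists F; split; first by exists f.
by move=> x y; apply: (can_inj fK); rewrite fM !f'K.
Qed.

Lemma nijenhuis_eigenbasis_iso g h n (zeta : n.-tuple h) :
  lie_isomorphic g h -> nijenhuis_eigenbasis zeta ->
  exists xi : n.-tuple g, nijenhuis_eigenbasis xi.
Proof.
case=> f [[f' fK f'K] fM] [zB zN].
have f'L : linear f' by apply: (can2_linear fK f'K).
pose F : {linear h -> g} := HB.pack f' (GRing.isLinear.Build _ _ _ _ f' f'L).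
have FE x : linfun F x = f' x by rewrite lfunE.
have F0 : lker (linfun F) == 0%VS.
  by apply/lker0P => x y; rewrite !FE; apply: (can_inj f'K).
exists (map_tuple (linfun F) zeta); split.
  (* Injectivity makes the image of [zeta] a basis of the image of [F], which is everything since
     [f'] is onto. *)
  have := limg_basis_of (f := linfun F) (U := fullv) (X := zeta).
  rewrite (eqP F0) capv0 => /(_ erefl zB).
  suff -> : (linfun F @: fullv)%VS = fullv by [].
  apply/eqP; rewrite eqEsubv subvf; apply/subvP => x _.
  by rewrite -(fK x) -FE memv_img ?memvf.
move=> i j; rewrite !tnth_map !FE.
have -> : lie (f' (tnth zeta i)) (f' (tnth zeta j)) =
          linfun F (lie (tnth zeta i) (tnth zeta j)).
  by apply: (can_inj fK); rewrite fM FE !f'K.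
have -> : [:: f' (tnth zeta i); f' (tnth zeta j)] =
   map (linfun F) [:: tnth zeta i; tnth zeta j] by rewrite /= !FE.
by rewrite -limg_span memv_img.
Qed.

(** The three cyclic pairs suffice: diagonal brackets vanish, and reversing a pair changes only a
    sign and the order of the generators. *)
Lemma nijenhuis_eigenbasis3 g (x y z : g) :
  basis_of {:g} [tuple x; y; z] ->
  lie x y \in <<[:: x; y]>>%VS -> lie y z \in <<[:: y; z]>>%VS ->
  lie z x \in <<[:: z; x]>>%VS ->
  nijenhuis_eigenbasis [tuple x; y; z].
Proof.
move=> B xy yz zx; split=> // i j.
have spanC (a b : g) : <<[:: a; b]>>%VS = <<[:: b; a]>>%VS.
  by rewrite !span_cons span_nil !addv0 addvC.
have flip (a b : g) :
    lie a b \in <<[:: a; b]>>%VS -> lie b a \in <<[:: b; a]>>%VS.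
  by rewrite lieC memvN spanC.
case: i => [[|[|[|//]]] ?]; case: j => [[|[|[|//]]] ?];
  rewrite !(tnth_nth 0) /= ?liexx ?mem0v //; exact: flip.
Qed.

Lemma lin_comb_span2 (V : vectType K) (x y : V) a b :
  a *: x + b *: y \in <<[:: x; y]>>%VS.
Proof. by rewrite memvD ?memvZ // memv_span ?inE ?eqxx ?orbT. Qed.

Lemma span2P (V : vectType K) (x y v : V) :
  v \in <<[:: x; y]>>%VS -> exists ab : K * K, v = ab.1 *: x + ab.2 *: y.
Proof.
rewrite span_cons span_seq1.
case/memv_addP => [_ /vlineP [a ->]] [_ /vlineP [b ->]] ->.
by exists (a, b).
Qed.

End LieAlgebras.

(** * Structure constants and changes of basis *)

Section Coordinates.
Variable K : fieldType.
Implicit Types g h : lieAlgType K.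
Implicit Types c d x y : 'rV[K]_3.

(** For [V] the row space itself, this is the change-of-basis map sending [eta1], [eta2], [eta3] to
    [e1], [e2], [e3]. *)
Definition comb3 (V : lmodType K) (e1 e2 e3 : V) x : V :=
  x 0 0 *: e1 + x 0 1 *: e2 + x 0 2%:R *: e3.

Lemma comb3_linear (V : lmodType K) (e1 e2 e3 : V) : linear (comb3 e1 e2 e3).
Proof.
move=> a x y; rewrite /comb3 !mxE !scalerDl !scalerDr !scalerA.
by rewrite [RHS]addrACA [X in _ = X + _]addrACA.
Qed.

HB.instance Definition _ (V : lmodType K) (e1 e2 e3 : V) :=
  GRing.isLinear.Build K 'rV[K]_3 V *:%R (comb3 e1 e2 e3)
    (comb3_linear e1 e2 e3).

Lemma ord3P (P : 'I_3 -> Prop) : P 0 -> P 1 -> P 2%:R -> forall i, P i.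
Proof.
move=> P0 P1 P2 [[|[|[|//]]] lt_i3];
  by [congr P: P0; apply: val_inj | congr P: P1; apply: val_inj
     | congr P: P2; apply: val_inj].
Qed.

Lemma comb3_eta x : comb3 eta1 eta2 eta3 x = x.
Proof. by apply/rowP; apply: ord3P; rewrite /comb3 !mxE /=; ring. Qed.

Lemma basis_of3 (V : vectType K) (x y z : V) : \dim {:V} = 3%N ->
  (forall a b k, a *: x + b *: y + k *: z = 0 -> [/\ a = 0, b = 0 & k = 0]) ->
  basis_of {:V} [tuple x; y; z].
Proof.
move=> dimV xyz0; rewrite basisEfree subvf dimV !andbT.
apply/freeP => k; rewrite !big_ord_recl big_ord0 /= addr0 addrA.
case/xyz0 => k0 k1 k2.
by apply: ord3P; [rewrite -[RHS]k0 | rewrite -[RHS]k1 | rewrite -[RHS]k2];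
  congr k; apply: val_inj.
Qed.

Lemma comb3_bij (V : vectType K) (zeta : 3.-tuple V) : basis_of {:V} zeta ->
  bijective (comb3 (tnth zeta 0) (tnth zeta 1) (tnth zeta 2%:R)).
Proof.
move=> zB; have zfree := basis_free zB.
have E x : comb3 (tnth zeta 0) (tnth zeta 1) (tnth zeta 2%:R) x =
   \sum_i x 0 i *: zeta`_i.
  rewrite !big_ord_recl big_ord0 addr0 addrA /comb3 !(tnth_nth 0).
  by do !congr (_ + _); congr (_ *: _); congr (x _ _); apply: val_inj.
exists (fun v => \row_i coord zeta i v) => [x|v].
  by apply/rowP => i; rewrite E !mxE coord_sum_free.
rewrite E [RHS](coord_basis zB) ?memvf //.
by apply: eq_bigr => i _; rewrite mxE.
Qed.

Lemma alternating_bilinear3 (B : 'rV[K]_3 -> 'rV[K]_3 -> 'rV[K]_3) :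
  (forall y, linear (B^~ y)) -> (forall x, linear (B x)) ->
  (forall x, B x x = 0) ->
  forall x y,
    B x y = bracket3 (B eta1 eta2) (B eta2 eta3) (B eta3 eta1) x y.
Proof.
move=> Bl Br Bxx; have BC := alternating_skew Bl Br Bxx.
have B0l y : B 0 y = 0.
  by have := Bl y (-1) 0 0; rewrite scaler0 addr0 scaleN1r addNr.
have B0r y : B y 0 = 0 by rewrite BC B0l oppr0.
(* The trailing 0 gives every summand the shape [a *: x + y] on which [linear] rewrites. *)
have El a b k y : B (a *: eta1 + (b *: eta2 + (k *: eta3 + 0))) y =
    a *: B eta1 y + (b *: B eta2 y + (k *: B eta3 y + 0)).
  by rewrite (Bl y a) (Bl y b) (Bl y k) B0l.
have Er a b k y : B y (a *: eta1 + (b *: eta2 + (k *: eta3 + 0))) =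
    a *: B y eta1 + (b *: B y eta2 + (k *: B y eta3 + 0)).
  by rewrite (Br y a) (Br y b) (Br y k) B0r.
move=> x y; rewrite -{1}(comb3_eta x) -{1}(comb3_eta y) /comb3 -!addrA.
rewrite -[x 0 2%:R *: _]addr0 -[y 0 2%:R *: _]addr0 El !Er !Bxx.
rewrite (BC eta1 eta2) (BC eta2 eta3) (BC eta3 eta1) /bracket3.
by apply/rowP => i; rewrite !mxE; ring.
Qed.

(* [g] has a basis in which the brackets [e1,e2], [e2,e3], [e3,e1] have
   coordinates c12, c23, c31. *)
Definition lie_coords g c12 c23 c31 : Prop :=
  exists f : {linear 'rV[K]_3 -> g},
    bijective f /\ {morph f : x y / bracket3 c12 c23 c31 x y >-> lie x y}.

(** Pulled back along [z], the bracket is alternating and bilinear on rows, so its values on three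
    pairs determine it. *)
Lemma lie_coords_basis g (zeta : 3.-tuple g) c12 c23 c31 :
  let z := comb3 (tnth zeta 0) (tnth zeta 1) (tnth zeta 2%:R) in
  basis_of {:g} zeta ->
  lie (tnth zeta 0) (tnth zeta 1) = z c12 ->
  lie (tnth zeta 1) (tnth zeta 2%:R) = z c23 ->
  lie (tnth zeta 2%:R) (tnth zeta 0) = z c31 ->
  lie_coords g c12 c23 c31.
Proof.
move=> z zB; have [z' zK z'K] := comb3_bij zB.
have zL : linear z by exact: comb3_linear.
have z'L : linear z' by apply: (can2_linear (f := z) zK z'K).
move=> e12 e23 e31; exists z; split; first by exists z'.
move=> x y; apply: (can_inj z'K); rewrite zK.
pose B x y := z' (lie (z x) (z y)).
have := @alternating_bilinear3 B _ _ _ x y; rewrite /B => ->; first last.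
- move=> u; rewrite liexx; apply: (can_inj zK).
  by rewrite z'K; apply/esym/linear0.
- by move=> u a v w; rewrite /= zL lie_linearr z'L.
- by move=> u a v w; rewrite /= zL lie_linearl z'L.
have ze1 : z eta1 = tnth zeta 0.
  by rewrite /z /comb3 !mxE /= scale1r !scale0r !addr0.
have ze2 : z eta2 = tnth zeta 1.
  by rewrite /z /comb3 !mxE /= scale1r !scale0r addr0 add0r.
have ze3 : z eta3 = tnth zeta 2%:R.
  by rewrite /z /comb3 !mxE /= scale1r !scale0r !add0r.
by rewrite ze1 ze2 ze3 e12 e23 e31 !zK.
Qed.

(** The [p] rows are the new basis vectors in old coordinates, the [q] rows the old ones in new
    coordinates. With explicit rows all hypotheses become scalar identities. *)
Lemma lie_coords_change g c12 c23 c31 d12 d23 d31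
    (p1 p2 p3 q1 q2 q3 : 'rV[K]_3) :
  lie_coords g c12 c23 c31 ->
  cancel (comb3 p1 p2 p3) (comb3 q1 q2 q3) ->
  cancel (comb3 q1 q2 q3) (comb3 p1 p2 p3) ->
  {morph comb3 p1 p2 p3 : x y /
     bracket3 d12 d23 d31 x y >-> bracket3 c12 c23 c31 x y} ->
  lie_coords g d12 d23 d31.
Proof.
move=> [f [fB fM]] pK qK pM.
exists (f \o comb3 p1 p2 p3); split; last by move=> x y /=; rewrite pM fM.
by apply: bij_comp => //; exists (comb3 q1 q2 q3).
Qed.

End Coordinates.

(** * Arithmetic of explicit coordinate triples *)

Section Rows.
Variable K : fieldType.
Implicit Types g : lieAlgType K.

Definition row3 (a b c : K) : 'rV[K]_3 := \row_i [:: a; b; c]`_i.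

Lemma row3E a b c :
  [/\ row3 a b c 0 0 = a, row3 a b c 0 1 = b & row3 a b c 0 2%:R = c].
Proof. by rewrite !mxE. Qed.

Lemma row3_eq (x : 'rV[K]_3) a b c :
  x 0 0 = a -> x 0 1 = b -> x 0 2%:R = c -> x = row3 a b c.
Proof.
move=> <- <- <-; have [r0 r1 r2] := row3E (x 0 0) (x 0 1) (x 0 2%:R).
by apply/rowP; apply: ord3P.
Qed.

Lemma row3P x : {abc : K * K * K | x = row3 abc.1.1 abc.1.2 abc.2}.
Proof. by exists (x 0 0, x 0 1, x 0 2%:R); apply: row3_eq. Qed.

Lemma row3D a b c a' b' c' :
  row3 a b c + row3 a' b' c' = row3 (a + a') (b + b') (c + c').
Proof.
have [r0 r1 r2] := row3E a b c; have [r0' r1' r2'] := row3E a' b' c'.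
by apply: row3_eq; rewrite mxE ?r0 ?r1 ?r2 ?r0' ?r1' ?r2'.
Qed.

Lemma row3Z k a b c : k *: row3 a b c = row3 (k * a) (k * b) (k * c).
Proof.
by have [r0 r1 r2] := row3E a b c; apply: row3_eq; rewrite mxE ?r0 ?r1 ?r2.
Qed.

Lemma row3N a b c : - row3 a b c = row3 (- a) (- b) (- c).
Proof. by rewrite -scaleN1r row3Z !mulN1r. Qed.

Lemma row3_inj a b c a' b' c' :
  row3 a b c = row3 a' b' c' -> [/\ a = a', b = b' & c = c'].
Proof.
have [r0 r1 r2] := row3E a b c; have [r0' r1' r2'] := row3E a' b' c'.
by move=> E; split; [rewrite -r0 E r0' | rewrite -r1 E r1' | rewrite -r2 E r2'].
Qed.

Lemma eta_row3 : [/\ eta1 = row3 1 0 0, eta2 = row3 0 1 0 & eta3 = row3 0 0 1].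
Proof. by split; apply: row3_eq; rewrite mxE. Qed.

Lemma row3_0 : 0 = row3 0 0 0.
Proof. by apply: row3_eq; rewrite mxE. Qed.

Lemma bracket3_row3 c12 c23 c31 a b c a' b' c' :
  bracket3 c12 c23 c31 (row3 a b c) (row3 a' b' c') =
    (a * b' - b * a') *: c12 + (b * c' - c * b') *: c23 +
    (c * a' - a * c') *: c31.
Proof.
have [r0 r1 r2] := row3E a b c; have [r0' r1' r2'] := row3E a' b' c'.
by rewrite /bracket3 r0 r1 r2 r0' r1' r2'.
Qed.

Lemma comb3_row3 (V : lmodType K) (e1 e2 e3 : V) a b c :
  comb3 e1 e2 e3 (row3 a b c) = a *: e1 + b *: e2 + c *: e3.
Proof. by have [r0 r1 r2] := row3E a b c; rewrite /comb3 r0 r1 r2. Qed.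

(** Pushes every operation inside [row3], so that [congr row3] leaves goals for [ring] or
    [field]. *)
Definition row3S := (bracket3_row3, comb3_row3, row3Z, row3N, row3D).

(** * Recognising the three models from structure constants *)

Lemma lie_coords_a34 g :
  lie_coords g (row3 0 0 (-1)) (row3 1 0 0) (row3 0 1 0) ->
  lie_isomorphic g (a34 K).
Proof.
have -> : row3 0 0 (-1) = - eta3.
  by have [_ _ ->] := eta_row3; rewrite row3N oppr0.
have [<- <- _] := eta_row3.
(* [lie] on [a34 K] unfolds to this very [bracket3], so [f] is already a morphism. *)
by case=> f [fB fM]; apply: (@lie_isomorphic_inv K g (a34 K) f).
Qed.

Lemma lie_coords_a35 g :
  lie_coords g (row3 0 1 0) (row3 0 0 0) (row3 0 0 (-1)) ->
  lie_isomorphic g (a35 K).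
Proof.
have -> : row3 0 0 (-1) = - eta3.
  by have [_ _ ->] := eta_row3; rewrite row3N oppr0.
have [_ <- _] := eta_row3; rewrite -row3_0.
by case=> f [fB fM]; apply: (@lie_isomorphic_inv K g (a35 K) f).
Qed.

Lemma lie_coords_a38 g b :
  lie_coords g (row3 0 b (-1)) (row3 0 0 0) (row3 0 1 (- b)) ->
  lie_isomorphic g (a38 b).
Proof.
have [_ e2 e3] := eta_row3.
have -> : row3 0 b (-1) = b *: eta2 - eta3.
  by rewrite e2 e3 !row3S; congr row3; ring.
have -> : row3 0 1 (- b) = eta2 - b *: eta3.
  by rewrite e2 e3 !row3S; congr row3; ring.
rewrite -row3_0.
by case=> f [fB fM]; apply: (@lie_isomorphic_inv K g (a38 b) f).
Qed.

(* [e1,e2] = l e2, [e1,e3] = m e3 and [e2,e3] = 0. *)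
Definition diag_coords g l m :=
  lie_coords g (row3 0 l 0) (row3 0 0 0) (row3 0 0 (- m)).

Lemma diag_coords_scalar g l : l != 0 ->
  diag_coords g l l -> lie_isomorphic g (a35 K).
Proof.
move=> l0 /(lie_coords_change
  (d12 := row3 0 1 0) (d23 := row3 0 0 0) (d31 := row3 0 0 (-1))
  (p1 := row3 l^-1 0 0) (p2 := row3 0 1 0) (p3 := row3 0 0 1)
  (q1 := row3 l 0 0) (q2 := row3 0 1 0) (q3 := row3 0 0 1)) change.
by apply/lie_coords_a35/change => [x|x|x y]; have [[[x0 x1] x2] ->] := row3P x;
  try (have [[[y0 y1] y2] ->] := row3P y);
  rewrite /= !row3S; congr row3; field.
Qed.

(** In [a38 b], [eta2 - eta3] and [eta2 + eta3] are eigenvectors of ad [eta1] for b + 1 and b - 1.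
    Scaling e1 by 2 / (l - m) makes the eigenvalues differ by 2; [b] is then their mean. *)
Lemma diag_coords_neq g l m : 2%:R != 0 :> K -> l != m ->
  diag_coords g l m -> lie_isomorphic g (a38 ((l + m) / (l - m))).
Proof.
move=> two0; rewrite -subr_eq0; set b := _ / _ => lm0.
move=> /(lie_coords_change
  (d12 := row3 0 b (-1)) (d23 := row3 0 0 0) (d31 := row3 0 1 (- b))
  (p1 := row3 (2%:R / (l - m)) 0 0)
  (p2 := row3 0 2%:R^-1 2%:R^-1) (p3 := row3 0 (- 2%:R^-1) 2%:R^-1)
  (q1 := row3 ((l - m) / 2%:R) 0 0)
  (q2 := row3 0 1 (-1)) (q3 := row3 0 1 1)) change.
by apply/lie_coords_a38/change => [x|x|x y]; have [[[x0 x1] x2] ->] := row3P x;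
  try (have [[[y0 y1] y2] ->] := row3P y);
  rewrite /= !row3S /b; congr row3; field; rewrite ?two0 ?lm0.
Qed.

(** * Structure constants in a Nijenhuis eigenbasis *)

(* [e1,e2] = p e1 + q e2, [e2,e3] = r e2 + s e3 and [e3,e1] = t e3 + u e1; this
   parameter order makes the cyclic symmetry a rotation of the parameters by two. *)
Definition nijenhuis_coords g p q r s t u :=
  lie_coords g (row3 p q 0) (row3 0 r s) (row3 u 0 t).

Lemma nijenhuis_coords_cycle g p q r s t u :
  nijenhuis_coords g p q r s t u -> nijenhuis_coords g r s t u p q.
Proof.
move=> /(lie_coords_change
  (d12 := row3 r s 0) (d23 := row3 0 t u) (d31 := row3 q 0 p)
  (p1 := row3 0 1 0) (p2 := row3 0 0 1) (p3 := row3 1 0 0)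
  (q1 := row3 0 0 1) (q2 := row3 1 0 0) (q3 := row3 0 1 0)) change.
by apply: change => [x|x|x y]; have [[[x0 x1] x2] ->] := row3P x;
  try (have [[[y0 y1] y2] ->] := row3P y);
  rewrite /= !row3S; congr row3; ring.
Qed.

(** The three equations are the coordinates of the Jacobi identity on the basis vectors, after two
    opposite terms cancel in each. *)
Lemma nijenhuis_coords_jacobi g p q r s t u :
  nijenhuis_coords g p q r s t u ->
  [/\ r * p = s * u, t * r = u * q & p * t = q * s].
Proof.
case=> f [/bij_inj f_inj fM].
have := lie_jacobi (f (row3 1 0 0)) (f (row3 0 1 0)) (f (row3 0 0 1)).
rewrite -!fM -!linearD -[RHS](linear0 f) => /f_inj.
rewrite row3_0 !row3S => /row3_inj [E0 E1 E2].
by split; apply/eqP; rewrite -subr_eq0; apply/eqP;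
  [rewrite -[RHS]E0 | rewrite -[RHS]E1 | rewrite -[RHS]E2]; ring.
Qed.

Lemma nijenhuis_coords_abelian g :
  nijenhuis_coords g 0 0 0 0 0 0 -> lie_abelian g.
Proof.
case=> f [[f' fK f'K] fM] x y; rewrite -(f'K x) -(f'K y) -fM -row3_0.
by rewrite /bracket3 !scaler0 !addr0 linear0.
Qed.

(** Here [x,y] = alpha(x) y - alpha(y) x with alpha = (q, -p, u). Adding multiples of e1 moves e2
    and e3 into the kernel of alpha, on which e1 acts as the scalar [q]. *)
Lemma nijenhuis_coords_anti g p q u : q != 0 ->
  nijenhuis_coords g p q (- u) (- p) (- q) u -> lie_isomorphic g (a35 K).
Proof.
move=> q0 /(lie_coords_change
  (d12 := row3 0 q 0) (d23 := row3 0 0 0) (d31 := row3 0 0 (- q))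
  (p1 := row3 1 0 0) (p2 := row3 (p / q) 1 0) (p3 := row3 (- (u / q)) 0 1)
  (q1 := row3 1 0 0) (q2 := row3 (- (p / q)) 1 0) (q3 := row3 (u / q) 0 1))
  change.
by apply: (diag_coords_scalar q0); apply: change => [x|x|x y];
  have [[[x0 x1] x2] ->] := row3P x;
  try (have [[[y0 y1] y2] ->] := row3P y);
  rewrite /= !row3S; congr row3; field.
Qed.

(** On e1/q, e2/p, e3/r each cyclic bracket is the sum of its arguments. The [q] rows say that these
    vectors are -zeta1, zeta2, -zeta3/2 for the eigenbasis of [a34] in the theorem. *)
Lemma nijenhuis_coords_sym g p q r :
  2%:R != 0 :> K -> p != 0 -> q != 0 -> r != 0 ->
  nijenhuis_coords g p q r p q r -> lie_isomorphic g (a34 K).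
Proof.
move=> two0 p0 q0 r0.
move=> /(lie_coords_change
  (d12 := row3 0 0 (-1)) (d23 := row3 1 0 0) (d31 := row3 0 1 0)
  (p1 := row3 0 0 (- r^-1))
  (p2 := row3 (- (2%:R * q)^-1) (2%:R * p)^-1 0)
  (p3 := row3 (- (2%:R * q)^-1) (- (2%:R * p)^-1) (- r^-1))
  (q1 := row3 q (- q) (- q)) (q2 := row3 p p (- p))
  (q3 := row3 (- r) 0 0)) change.
by apply: lie_coords_a34; apply: change => [x|x|x y];
  have [[[x0 x1] x2] ->] := row3P x;
  try (have [[[y0 y1] y2] ->] := row3P y);
  rewrite /= !row3S; congr row3; field; rewrite ?two0 ?p0 ?q0 ?r0.
Qed.

(** The vector e3 + k e1 commutes with e2 and is an eigenvector of ad e1 for -t. *)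
Lemma nijenhuis_coords_diagl g k q t :
  nijenhuis_coords g 0 q (k * q) 0 t (k * t) -> diag_coords g q (- t).
Proof.
move=> /(lie_coords_change
  (d12 := row3 0 q 0) (d23 := row3 0 0 0) (d31 := row3 0 0 (- - t))
  (p1 := row3 1 0 0) (p2 := row3 0 1 0) (p3 := row3 k 0 1)
  (q1 := row3 1 0 0) (q2 := row3 0 1 0) (q3 := row3 (- k) 0 1)) change.
by apply: change => [x|x|x y]; have [[[x0 x1] x2] ->] := row3P x;
  try (have [[[y0 y1] y2] ->] := row3P y);
  rewrite /= !row3S; congr row3; ring.
Qed.

(** Only ad e3 acts, diagonally on e2 and e1, so e1 and e3 are exchanged. *)
Lemma nijenhuis_coords_diagr g r u :
  nijenhuis_coords g 0 0 r 0 0 u -> diag_coords g (- r) u.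
Proof.
move=> /(lie_coords_change
  (d12 := row3 0 (- r) 0) (d23 := row3 0 0 0) (d31 := row3 0 0 (- u))
  (p1 := row3 0 0 1) (p2 := row3 0 1 0) (p3 := row3 1 0 0)
  (q1 := row3 0 0 1) (q2 := row3 0 1 0) (q3 := row3 1 0 0)) change.
by apply: change => [x|x|x y]; have [[[x0 x1] x2] ->] := row3P x;
  try (have [[[y0 y1] y2] ->] := row3P y);
  rewrite /= !row3S; congr row3; ring.
Qed.

(** * Solving the Jacobi equations and identifying each case *)

Lemma jacobi_coords_cases (p q r s t u : K) :
  r * p = s * u -> t * r = u * q -> p * t = q * s ->
  [\/ [\/ p = 0 /\ s = 0, r = 0 /\ u = 0 | t = 0 /\ q = 0],
      [/\ r = - u, s = - p & t = - q] |
      [/\ [/\ r = u, s = p & t = q], p != 0, q != 0 & u != 0]].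
Proof.
(* If no pair vanishes, no entry does: from b = 0 and c nonzero the equations force d = 0, then f =
   0, then e a = 0, so one of the other pairs vanishes. *)
have neq0 (a b c d e f : K) : a * b = c * d -> b * e = f * c -> e * a = d * f ->
    ~~ ((b == 0) && (c == 0)) -> ~~ ((a == 0) && (d == 0)) ->
    ~~ ((e == 0) && (f == 0)) -> b != 0.
  move=> E1 E2 E3 bc ad ef; apply/negP => /eqP b0.
  move: bc; rewrite b0 eqxx /= => c0.
  move/esym/eqP: E1; rewrite b0 mulr0 mulf_eq0 (negPf c0) /= => d0.
  move/esym/eqP: E2; rewrite b0 mul0r mulf_eq0 (negPf c0) orbF => f0.
  move/eqP: E3; rewrite (eqP d0) mul0r mulf_eq0 orbC.
  by move: ad ef; rewrite d0 f0 !andbT => /negPf -> /negPf ->.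
move=> E1 E2 E3.
have [/andP[/eqP ? /eqP ?]|ps] := boolP ((p == 0) && (s == 0)).
  by apply: Or31; apply: Or31.
have [/andP[/eqP ? /eqP ?]|ru] := boolP ((r == 0) && (u == 0)).
  by apply: Or31; apply: Or32.
have [/andP[/eqP ? /eqP ?]|tq] := boolP ((t == 0) && (q == 0)).
  by apply: Or31; apply: Or33.
have p0 : p != 0 by exact: (neq0 r p s u t q).
move: ps ru tq; rewrite andbC => sp; rewrite andbC => ur; rewrite andbC => qt.
(* The same system with the members of each pair exchanged, so that [neq0] applies to the other
   entries. *)
have E1' : u * s = p * r by rewrite mulrC -E1 mulrC.
have E2' : q * u = r * t by rewrite mulrC -E2 mulrC.
have E3' : s * q = t * p by rewrite mulrC -E3 mulrC.
have s0 : s != 0 by exact: (neq0 u s p r q t).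
have q0 : q != 0 by exact: (neq0 s q t p u r).
have u0 : u != 0 by exact: (neq0 q u r t s p).
(* Multiply the first two equations and cancel the third; the sign in r = u or r = -u then fixes the
   other two pairs. *)
have : r ^+ 2 == u ^+ 2.
  apply/eqP/(mulIf (mulf_neq0 q0 s0)).
  have -> : r ^+ 2 * (q * s) = (r * p) * (t * r) by rewrite -E3; ring.
  by rewrite E1 E2; ring.
rewrite eqf_sqr => /orP[] /eqP ru0; [apply: Or33 | apply: Or32].
  have spE : s = p by apply: (mulIf u0); rewrite -E1 ru0 mulrC.
  by split=> //; split=> //; apply: (mulfI p0); rewrite E3 spE mulrC.
have spE : s = - p by apply: (mulIf u0); rewrite -E1 ru0; ring.
by split=> //; apply: (mulfI p0); rewrite E3 spE; ring.
Qed.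

Definition nijenhuis_type g : Prop :=
  [\/ lie_isomorphic g (a34 K), lie_isomorphic g (a35 K)
    | exists b : K, lie_isomorphic g (a38 b)].

Lemma diag_coords_type g l m : 2%:R != 0 :> K -> (l != 0) || (m != 0) ->
  diag_coords g l m -> nijenhuis_type g.
Proof.
move=> two0; have [<- | lm _] := eqVneq l m.
  by rewrite orbb => l0 /(diag_coords_scalar l0); apply: Or32.
move=> /(diag_coords_neq two0 lm) iso.
by apply: Or33; exists ((l + m) / (l - m)).
Qed.

Lemma nijenhuis_coords_degenerate g q r t u :
  2%:R != 0 :> K -> ~ lie_abelian g ->
  nijenhuis_coords g 0 q r 0 t u -> nijenhuis_type g.
Proof.
move=> two0 gN gC; have [_ E _] := nijenhuis_coords_jacobi gC.
have [qt0 | qt] := boolP ((q == 0) && (t == 0)).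
  case/andP: qt0 gC => /eqP-> /eqP-> gC.
  apply: diag_coords_type (nijenhuis_coords_diagr gC) => //.
  rewrite oppr_eq0 -negb_and; apply/negP => /andP[/eqP r0 /eqP u0].
  by apply: gN; move: gC; rewrite r0 u0; apply: nijenhuis_coords_abelian.
(* The determinant t r - u q vanishes and (q, t) is nonzero, so (r, u) is a multiple of (q, t). *)
have [k [rE uE]] : exists k, r = k * q /\ u = k * t.
  have [q0 | q0] := eqVneq q 0.
    move: qt E; rewrite q0 eqxx /= mulr0 => t0 /eqP.
    rewrite mulf_eq0 (negPf t0) => /eqP ->.
    by exists (u / t); rewrite mulr0 mulfVK.
  exists (r / q); rewrite mulfVK //; split=> //.
  by apply: (mulIf q0); rewrite -E; field.
apply: (@diag_coords_type g q (- t)) => //; first by rewrite oppr_eq0 -negb_and.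
by apply: (@nijenhuis_coords_diagl g k); rewrite -rE -uE.
Qed.

Lemma nijenhuis_coords_type g p q r s t u :
  2%:R != 0 :> K -> ~ lie_abelian g ->
  nijenhuis_coords g p q r s t u -> nijenhuis_type g.
Proof.
move=> two0 gN gC; have [E1 E2 E3] := nijenhuis_coords_jacobi gC.
have degenerate := nijenhuis_coords_degenerate two0 gN.
have [[][z1 z2] | [rE sE tE] | [[rE sE tE] p0 q0 u0]] :=
  jacobi_coords_cases E1 E2 E3.
- by apply: (degenerate q r t u); move: gC; rewrite z1 z2.
(* Rotating the basis once, or twice in the next case, brings the vanishing pair to the positions of
   [p] and [s]. *)
- apply: (degenerate s t p q).
  by move: gC => /nijenhuis_coords_cycle; rewrite z1 z2.
- apply: (degenerate u p r s).
  by move: gC => /nijenhuis_coords_cycle/nijenhuis_coords_cycle; rewrite z1 z2.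
- apply: Or32; move: gC; rewrite rE sE tE => gC.
  (* Rotate until alpha is nonzero on the first basis vector; alpha = 0 would make [g] abelian. *)
  have [q0 | q0] := eqVneq q 0; last exact: nijenhuis_coords_anti gC.
  have [u0 | u0] := eqVneq u 0.
    have [p0 | p0] := eqVneq p 0.
      case: gN; move: gC; rewrite p0 q0 u0 oppr0.
      exact: nijenhuis_coords_abelian.
    apply: (@nijenhuis_coords_anti g (- u) (- p) q); first by rewrite oppr_eq0.
    by rewrite !opprK; apply: nijenhuis_coords_cycle.
  apply: (@nijenhuis_coords_anti g (- q) u (- p)) => //.
  by rewrite !opprK; do 2 apply: nijenhuis_coords_cycle.
- by apply: Or31; move: gC; rewrite rE sE tE; apply: nijenhuis_coords_sym.
Qed.

Lemma nijenhuis_eigenbasis_coords g (zeta : 3.-tuple g) :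
  nijenhuis_eigenbasis zeta ->
  exists p q r s t u, nijenhuis_coords g p q r s t u.
Proof.
case=> zB zN.
have [[p q] /= pq] := span2P (zN 0 1).
have [[r s] /= rs] := span2P (zN 1 2%:R).
have [[t u] /= tu] := span2P (zN 2%:R 0).
exists p, q, r, s, t, u; apply: (lie_coords_basis zB);
  by rewrite ?pq ?rs ?tu comb3_row3 !scale0r ?addr0 ?add0r // addrC.
Qed.

(** * Explicit eigenbases of the models *)

Lemma dim_rV3 : \dim {:'rV[K]_3} = 3%N.
Proof. by rewrite dimvf /dim /= mul1n. Qed.

Lemma lie_a34E a b c a' b' c' :
  lie (row3 a b c : a34 K) (row3 a' b' c') =
  row3 (b * c' - c * b') (c * a' - a * c') (b * a' - a * b').
Proof.
have [e1 e2 e3] := eta_row3.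
rewrite /lie /= /a34_lie e1 e2 e3 !row3S; congr row3; ring.
Qed.

Lemma lie_a38E (k a b c a' b' c' : K) :
  lie (row3 a b c : a38 k) (row3 a' b' c') =
  row3 0 (k * (a * b' - b * a') + (c * a' - a * c'))
    (- (a * b' - b * a') - k * (c * a' - a * c')).
Proof.
have [_ e2 e3] := eta_row3.
rewrite /lie /= /a38_lie e2 e3 row3_0 !row3S; congr row3; ring.
Qed.

(** The form alpha(x) y - alpha(y) x, with alpha the first coordinate, puts each bracket in the span
    of its arguments; hence every basis qualifies. *)
Lemma lie_a35E (x y : a35 K) :
  lie x y = (x : 'rV[K]_3) 0 0 *: y - (y : 'rV[K]_3) 0 0 *: x.
Proof.
have [_ e2 e3] := eta_row3.
have [[[x0 x1] x2] ->] := row3P x; have [[[y0 y1] y2] ->] := row3P y.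
have [-> _ _] := row3E x0 x1 x2; have [-> _ _] := row3E y0 y1 y2.
rewrite /lie /= /a35_lie e2 e3 row3_0 !row3S /=; congr row3; ring.
Qed.

Lemma nijenhuis_eigenbasis_a35 (zeta : 3.-tuple (a35 K)) :
  basis_of {:a35 K} zeta -> nijenhuis_eigenbasis zeta.
Proof.
move=> zB; split=> // i j.
by rewrite lie_a35E addrC -scaleNr lin_comb_span2.
Qed.

Lemma nijenhuis_eigenbasis_a34 : 2%:R != 0 :> K ->
  nijenhuis_eigenbasis
    [tuple (- eta1 + eta2 + eta3 : a34 K); eta1 + eta2 - eta3; 2 *: eta1].
Proof.
move=> two0; have [e1 e2 e3] := eta_row3.
have -> : (- eta1 + eta2 + eta3 : a34 K) = row3 (-1) 1 1.
  by rewrite e1 e2 e3 !row3S; congr row3; ring.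
have -> : (eta1 + eta2 - eta3 : a34 K) = row3 1 1 (-1).
  by rewrite e1 e2 e3 !row3S; congr row3; ring.
have -> : (2 *: eta1 : a34 K) = row3 2%:R 0 0.
  by rewrite e1 !row3S; congr row3; ring.
apply: nijenhuis_eigenbasis3.
- apply: basis_of3 => [|a b k]; first exact: dim_rV3.
  rewrite !row3S row3_0 => /row3_inj [E0 E1 E2].
  have a0 : a = 0.
    apply: (mulfI two0); rewrite mulr0.
    (* The last two coordinates add up to 2a. *)
    by have := congr2 +%R E1 E2; rewrite addr0 => E12; rewrite -[RHS]E12; ring.
  have b0 : b = 0 by rewrite -[RHS]E1 a0; ring.
  by split=> //; apply: (mulfI two0); rewrite mulr0 -[RHS]E0 a0 b0; ring.
- have <- : 1 *: (row3 (-1) 1 1 : a34 K) + (-1) *: (row3 1 1 (-1) : a34 K) =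
      lie (row3 (-1) 1 1 : a34 K) (row3 1 1 (-1)).
    by rewrite lie_a34E !row3S; congr row3; ring.
  exact: lin_comb_span2.
- have <- : (-2%:R) *: (row3 1 1 (-1) : a34 K) + 1 *: (row3 2%:R 0 0 : a34 K) =
      lie (row3 1 1 (-1) : a34 K) (row3 2%:R 0 0).
    by rewrite lie_a34E !row3S; congr row3; ring.
  exact: lin_comb_span2.
- have <- : (-1) *: (row3 2%:R 0 0 : a34 K) +
      (-2%:R) *: (row3 (-1) 1 1 : a34 K) =
      lie (row3 2%:R 0 0 : a34 K) (row3 (-1) 1 1).
    by rewrite lie_a34E !row3S; congr row3; ring.
  exact: lin_comb_span2.
Qed.

(** zeta3 and zeta2 - zeta1 are the eigenvectors of ad [eta1], for l - 1 and l + 1, and each bracket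
    is a multiple of one of them. *)
Lemma nijenhuis_eigenbasis_a38 (l : K) : 2%:R != 0 :> K ->
  nijenhuis_eigenbasis
    [tuple (eta1 + eta3 : a38 l); eta1 + eta2; eta2 + eta3].
Proof.
move=> two0; have [e1 e2 e3] := eta_row3.
have -> : (eta1 + eta3 : a38 l) = row3 1 0 1.
  by rewrite e1 e3 !row3S; congr row3; ring.
have -> : (eta1 + eta2 : a38 l) = row3 1 1 0.
  by rewrite e1 e2 !row3S; congr row3; ring.
have -> : (eta2 + eta3 : a38 l) = row3 0 1 1.
  by rewrite e2 e3 !row3S; congr row3; ring.
apply: nijenhuis_eigenbasis3.
- apply: basis_of3 => [|a b k]; first exact: dim_rV3.
  rewrite !row3S row3_0 => /row3_inj [E0 E1 E2].
  have a0 : a = 0.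
    apply: (mulfI two0); rewrite mulr0.
    (* First plus third minus second coordinate is 2a. *)
    have := congr2 +%R (congr2 +%R E0 E2) (congr1 -%R E1).
    by rewrite oppr0 !addr0 => E021; rewrite -[RHS]E021; ring.
  have b0 : b = 0 by rewrite -[RHS]E0 a0; ring.
  by split=> //; rewrite -[RHS]E2 a0; ring.
- have <- : (- (l + 1)) *: (row3 1 0 1 : a38 l) +
      (l + 1) *: (row3 1 1 0 : a38 l) =
      lie (row3 1 0 1 : a38 l) (row3 1 1 0).
    by rewrite lie_a38E !row3S; congr row3; ring.
  exact: lin_comb_span2.
- have <- : 0 *: (row3 1 1 0 : a38 l) + (l - 1) *: (row3 0 1 1 : a38 l) =
      lie (row3 1 1 0 : a38 l) (row3 0 1 1).
    by rewrite lie_a38E !row3S; congr row3; ring.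
  exact: lin_comb_span2.
- have <- : (1 - l) *: (row3 0 1 1 : a38 l) + 0 *: (row3 1 0 1 : a38 l) =
      lie (row3 0 1 1 : a38 l) (row3 1 0 1).
    by rewrite lie_a38E !row3S; congr row3; ring.
  exact: lin_comb_span2.
Qed.

End Rows.

(** * Assembling the classification over the reals *)

Theorem theorem2 (R : realType) :
  [/\ forall g : lieAlgType R, \dim {:g} = 3%N -> ~ lie_abelian g ->
        ((exists zeta : 3.-tuple g, nijenhuis_eigenbasis zeta) <->
         [\/ lie_isomorphic g (a34 R), lie_isomorphic g (a35 R)
           | exists b : R, lie_isomorphic g (a38 b)]),
      nijenhuis_eigenbasis
        [tuple (- eta1 + eta2 + eta3 : a34 R); eta1 + eta2 - eta3; 2 *: eta1],
      forall zeta : 3.-tuple (a35 R),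
        basis_of {:a35 R} zeta -> nijenhuis_eigenbasis zeta
    & forall b : R,
        nijenhuis_eigenbasis
          [tuple (eta1 + eta3 : a38 b); eta1 + eta2; eta2 + eta3]].
Proof.
have two0 : 2%:R != 0 :> R by rewrite Num.Theory.pnatr_eq0.
split.
- move=> g _ gN; split.
    case=> zeta /nijenhuis_eigenbasis_coords [p [q [r [s [t [u gC]]]]]].
    exact: nijenhuis_coords_type gC.
  (* Any basis of [a35] will do; [vbasis] is indexed by the dimension, which is rewritten to 3. *)
  have [xi xiB] : exists xi : 3.-tuple (a35 R), basis_of {:a35 R} xi.
    have := vbasisP {:a35 R}; move: (vbasis _).
    by rewrite (dim_rV3 R : \dim {:a35 R} = 3%N) => xi xiB; exists xi.
  case=> [iso|iso|[b iso]]; apply: nijenhuis_eigenbasis_iso (iso) _.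
  + exact: nijenhuis_eigenbasis_a34.
  + exact: nijenhuis_eigenbasis_a35 xiB.
  + exact: nijenhuis_eigenbasis_a38.
- exact: nijenhuis_eigenbasis_a34.
- exact: nijenhuis_eigenbasis_a35.
- by move=> b; apply: nijenhuis_eigenbasis_a38.
Qed.
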